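(* Let $\pi=\{p_1,\ldots,p_n\}$ be a finite set of primes and let $G$ be a finite group. Suppose that $G$ has three $\pi$-special subgroups $A_1,A_2,A_3$ whose indices $|G:A_1|,|G:A_2|,|G:A_3|$ are pairwise coprime and each of them is either a $\pi$-number or a $\pi'$-number. Suppose also that at most one of the numbers $|G:A_1|,|G:A_2|,|G:A_3|$ is a $\pi'$-number. Then $G$ is $\pi$-special.
   Context: All groups are finite. $\pi'$ is the set of primes not in $\pi$. A $\pi$-number (respectively $\pi'$-number) is a positive integer all of whose prime divisors lie in $\pi$ (respectively $\pi'$). A group $G$ is $\pi$-special if $G=O_{p_1}(G)\times\cdots\times O_{p_n}(G)\times O_{\pi'}(G)$. *)

(* Defs.v *)
From mathcomp Require Import all_boot all_fingroup all_solvable.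
Set Implicit Arguments.
Unset Strict Implicit.
Unset Printing Implicit Defensive.
Local Open Scope group_scope.

(* [dprod] evaluates to the empty set when the product is not direct, so the  *)
(* equation says that G is the internal direct product of its cores.         *)
(* The sequence pi is meant to list distinct primes.                         *)
Definition pi_special (pi : seq nat) (gT : finGroupType) (G : {group gT}) :=
  (\big[dprod/1]_(p <- pi) 'O_p(G)) \x 'O_[pred q in pi]^'(G) = G.

(* Main.v *)
Require Import Defs.
From mathcomp Require Import all_boot all_fingroup all_solvable.
Local Open Scope group_scope.

(** A group is pi-special iff its cores O_p (p in pi) and O_pi' are Hall
    subgroups.  If A and B have coprime indices in G, then G = AB, so that a
    normal subgroup of A that is G-conjugate to a normal subgroup of B is equal
    to it and hence normal in G.  Each p in pi divides at most one of the three
    indices, so by Sylow's theorem G has a normal Sylow p-subgroup; hence G has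
    a nilpotent normal Hall pi-subgroup.  Two of the indices are pi-numbers, and
    the Hall pi'-subgroups of the two corresponding A_i are complements to it,
    conjugate by the Schur-Zassenhaus theorem, so they too are normal in G. *)

Lemma coprime_normal_dprodEY {gT : finGroupType} {G H K : {group gT}} :
  H <| G -> K <| G -> coprime #|H| #|K| -> H \x K = H <*> K.
Proof.
move=> nHG nKG co; have TI := coprime_TIg co.
apply: dprodEY => //; apply/commG1P/trivgP; rewrite -TI setIC.
apply: commg_subI; rewrite subsetI subxx /=.
  exact: subset_trans (normal_sub nKG) (normal_norm nHG).
exact: subset_trans (normal_sub nHG) (normal_norm nKG).
Qed.

(** Cores for distinct entries of [s] have coprime orders, so each new factor meets the product
    built so far trivially and [dprod] never falls back to the empty set. *)
Lemma bigdprod_pcore_nilpotent_normal (s : seq nat) (gT : finGroupType)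
    (G : {group gT}) :
  uniq s ->
  exists H : {group gT}, [/\ \big[dprod/1]_(p <- s) 'O_p(G) = H, H <| G,
    [pred q in s].-group H, nilpotent H & forall p, p \in s -> 'O_p(G) \subset H].
Proof.
elim: s => [|p s IHs] /=.
  by exists 1%G; rewrite big_nil normal1 nilpotent1; split=> //; apply: pgroup1.
case/andP=> s'p Us.
have [H [defH nHG sH nilH sOH]] := IHs Us.
have co: coprime #|'O_p(G)| #|H|.
  apply: (@pnat_coprime p); first exact: pcore_pgroup.
  apply: sub_in_pnat sH => q _; rewrite !inE => sq.
  by apply: contraNneq s'p => <-.
have dH := coprime_normal_dprodEY (pcore_normal p G) nHG co.
exists ('O_p(G) <*> H)%G; split.
- by rewrite big_cons defH dH.
- exact: normalY (pcore_normal p G) nHG.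
- rewrite /pgroup -(dprod_card dH) pnatM; apply/andP; split.
    apply: sub_in_pnat (pcore_pgroup p G) => q _.
    by rewrite !inE => ->.
  by apply: sub_in_pnat sH => q _; rewrite !inE => ->; rewrite orbT.
- by rewrite (dprod_nil dH) nilH andbT; apply: pgroup_nil (pcore_pgroup p G).
move=> q; rewrite inE => /predU1P[-> | sq]; first exact: joing_subl.
exact: subset_trans (sOH q sq) (joing_subr _ _).
Qed.

(** The product of the cores is direct in every [G], so the defining equation only asserts that its
    order is [#|G|], and this can be compared one prime at a time. *)
Lemma pi_specialP (pi : seq nat) (gT : finGroupType) (G : {group gT}) :
    uniq pi ->
  pi_special pi G <->
    (forall p, p \in pi -> p.-Sylow(G) 'O_p(G)) /\
    [pred q in pi]^'.-Hall(G) 'O_[pred q in pi]^'(G).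
Proof.
move=> Upi; rewrite /pi_special.
have [H [defH nHG piH _ sOH]] :=
  bigdprod_pcore_nilpotent_normal pi gT G Upi.
set rho := [pred q in pi] in piH *.
have co: coprime #|H| #|'O_rho^'(G)|.
  exact: pnat_coprime piH (pcore_pgroup _ _).
have dG := coprime_normal_dprodEY nHG (pcore_normal rho^' G) co.
split=> [defG | [sylG hallG]].
  split; last first.
    rewrite pHallE pcore_sub /= -(dprod_card defG) defH.
    rewrite partnM // part_p'nat ?mul1n ?part_pnat_id //.
      exact: pcore_pgroup.
    by rewrite pnatNK.
  move=> p pip; rewrite pHallE pcore_sub /= -(dprod_card defG).
  have cardH := bigdprod_card defH.
  (* [big_rem] isolates the factor at [p]; since [pi] has no repetition, the remaining factors have
     order prime to [p]. *)
  rewrite defH -cardH (big_rem p) //= partnM ?muln_gt0 ?cardG_gt0 ?prodn_gt0 //.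
  rewrite partnM ?prodn_gt0 //.
  rewrite part_pnat_id // ?[(#|'O_rho^'(G)|`_p)%N]part_p'nat.
  - rewrite part_p'nat ?muln1 // rem_filter //.
    rewrite big_filter; elim/big_ind: _ => // [m n pm pn | q].
      by rewrite pnatM pm.
    rewrite inE => /= neq.
    apply: sub_in_pnat (pcore_pgroup q G) => r _; rewrite !inE => /eqP->.
    exact: neq.
  - apply: sub_in_pnat (pcore_pgroup rho^' G) => r _; rewrite !inE.
    by apply: contraNneq => ->.
  - exact: pcore_pgroup.
rewrite defH dG; apply/eqP; rewrite eqEcard join_subG normal_sub // pcore_sub /=.
apply: dvdn_leq => //; apply/dvdn_partP=> // p _.
have [pip | pi'p] := boolP (p \in pi).
  rewrite -(card_Hall (sylG p pip)); apply: cardSg.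
  exact: subset_trans (sOH p pip) (joing_subl _ _).
apply: (@dvdn_trans #|'O_rho^'(G)|); last exact/cardSg/joing_subr.
(* For [p] outside [pi], the [p]-part of [#|G|] is that of its pi'-part, which is the order of
   ['O_rho^'(G)]. *)
rewrite (card_Hall hallG) -(@partn_part p rho^') ?dvdn_part // => q.
by rewrite !inE => /eqP->.
Qed.

Lemma pHall_trans {rho : nat_pred} {gT : finGroupType} {G A H : {group gT}} :
  A \subset G -> rho^'.-nat #|G : A| -> rho.-Hall(A) H -> rho.-Hall(G) H.
Proof.
move=> sAG rho'i /and3P[sHA rhoH rho'H]; apply/and3P; split=> //.
  exact: subset_trans sAG.
by rewrite -(Lagrange_index sAG sHA) pnatM rho'i.
Qed.

(** Write [x = a * b]. As [a] normalizes [H], [K = H :^ b]; as [b] normalizes [K], this forces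
    [H = K], a group normalized by both [A] and [B]. *)
Lemma conj_normal_mulG {gT : finGroupType} {G A B H K : {group gT}} {x : gT} :
  A * B = G -> H <| A -> K <| B -> x \in G -> K :=: H :^ x -> H <| G.
Proof.
move=> defG /andP[sHA nHA] /andP[sKB nKB]; rewrite -defG.
case/mulsgP=> a b Aa Bb ->; rewrite conjsgM (normsP nHA) // => defK.
have defH : H :=: K.
  by rewrite -[LHS](conjsgK b) -defK (normsP nKB) ?groupV.
by rewrite /normal (subset_trans sHA) ?mulG_subl // mul_subG // defH.
Qed.

(** The theorem reduces to this case by renumbering: two of its three indices are pi-numbers, and
    they are put first here. *)
Lemma pi_special_pi_indices (pi : seq nat) (gT : finGroupType)
    (G A1 A2 A3 : {group gT}) :
    all prime pi -> uniq pi ->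
    A1 \subset G -> A2 \subset G -> A3 \subset G ->
    pi_special pi A1 -> pi_special pi A2 -> pi_special pi A3 ->
    coprime #|G : A1| #|G : A2| -> coprime #|G : A1| #|G : A3| ->
    coprime #|G : A2| #|G : A3| ->
    [pred q in pi].-nat #|G : A1| -> [pred q in pi].-nat #|G : A2| ->
  pi_special pi G.
Proof.
move=> pi_pr Upi sA1 sA2 sA3.
case/(pi_specialP _ _ _ Upi) => syl1 hall1.
case/(pi_specialP _ _ _ Upi) => syl2 hall2.
case/(pi_specialP _ _ _ Upi) => syl3 _ co12 co13 co23 ix1 ix2.
have sylG p : p \in pi -> p.-Sylow(G) 'O_p(G).
  move=> pip; have p_pr := allP pi_pr p pip.
  have sylow_two (A B : {group gT}) : A \subset G -> B \subset G ->
      p.-Sylow(A) 'O_p(A) -> p.-Sylow(B) 'O_p(B) -> coprime #|G : A| #|G : B| ->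
      p^'.-nat #|G : A| -> p^'.-nat #|G : B| -> p.-Sylow(G) 'O_p(G).
    move=> sA sB sylA sylB co iA iB.
    have SA := pHall_trans sA iA sylA; have SB := pHall_trans sB iB sylB.
    have [x Gx defB] := Sylow_trans SA SB.
    have nG := conj_normal_mulG (coprime_index_mulG sA sB co)
      (pcore_normal p A) (pcore_normal p B) Gx defB.
    by rewrite (normal_Hall_pcore SA nG).
  have p'nat (A : {group gT}) : p^'.-nat #|G : A| = ~~ (p %| #|G : A|).
    by rewrite p'natE.
  have not_both m n : coprime m n -> p %| m -> ~~ (p %| n).
    move=> co pm; apply: contraL co => pn.
    rewrite /coprime; apply: contraL (prime_gt1 p_pr) => /eqP g1.
    by rewrite -leqNgt dvdn_leq // -g1 dvdn_gcd pm.
  (* By coprimality [p] divides at most one index, so two of the subgroups contain Sylow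
     [p]-subgroups of [G]. *)
  have [p1 | p'1] := boolP (p %| #|G : A1|).
    apply: (sylow_two A2 A3) => //; rewrite ?p'nat.
    - exact: syl2.
    - exact: syl3.
    - exact: not_both co12 p1.
    - exact: not_both co13 p1.
  have [p2 | p'2] := boolP (p %| #|G : A2|).
    apply: (sylow_two A1 A3) => //; rewrite ?p'nat //.
    - exact: syl1.
    - exact: syl3.
    - exact: not_both co23 p2.
  apply: (sylow_two A1 A2) => //; rewrite ?p'nat //.
    exact: syl1.
  exact: syl2.
apply/(pi_specialP _ _ _ Upi); split=> //.
set rho := [pred q in pi] in hall1 hall2 ix1 ix2 *.
have [H [_ nHG piH nilH sOH]] :=
  bigdprod_pcore_nilpotent_normal pi gT G Upi.
(* For each [q] in [pi], [H] contains the Sylow subgroup ['O_q(G)], so its index is prime to [q]. *)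
have hallH : rho.-Hall(G) H.
  rewrite /pHall normal_sub //= [rho.-group H]piH /=.
  apply/pnatP=> // q q_pr q_dv; rewrite !inE; apply: contraL q_dv => piq.
  rewrite -p'natE //; have /and3P[_ _] := sylG q piq; apply: pnat_dvd.
  exact: indexgS (sOH q piq).
have K1 : rho^'.-Hall(G) 'O_rho^'(A1).
  by apply: pHall_trans hall1; rewrite ?pnatNK.
have K2 : rho^'.-Hall(G) 'O_rho^'(A2).
  by apply: pHall_trans hall2; rewrite ?pnatNK.
have defG : H * 'O_rho^'(A1) = G.
  apply/sdprodW/(sdprod_normal_p'HallP nHG K1); exact: hallH.
have sK1N : 'O_rho^'(A1) \subset 'N(H).
  exact: subset_trans (pHall_sub K1) (normal_norm nHG).
have sK2 : 'O_rho^'(A2) \subset H * 'O_rho^'(A1) by rewrite defG (pHall_sub K2).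
have coHK1 : coprime #|H| #|'O_rho^'(A1)| := pnat_coprime piH (pcore_pgroup _ _).
have eqK : #|'O_rho^'(A2)| = #|'O_rho^'(A1)|.
  by rewrite (card_Hall K1) (card_Hall K2).
(* Both complements to [H] have the same order; [H] is solvable because it is nilpotent, so
   Schur-Zassenhaus makes them conjugate. *)
have [x Hx defK2] :=
  SchurZassenhaus_trans_sol (nilpotent_sol nilH) sK1N sK2 coHK1 eqK.
have nG := conj_normal_mulG (coprime_index_mulG sA1 sA2 co12)
  (pcore_normal _ A1) (pcore_normal _ A2) (subsetP (normal_sub nHG) x Hx) defK2.
by rewrite (normal_Hall_pcore K1 nG).
Qed.

Theorem corollary1p17 (pi : seq nat) (gT : finGroupType)
    (G A1 A2 A3 : {group gT})
    (pi_prime : all prime pi) (pi_uniq : uniq pi)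
    (sA1G : A1 \subset G) (sA2G : A2 \subset G) (sA3G : A3 \subset G)
    (spA1 : pi_special pi A1) (spA2 : pi_special pi A2)
    (spA3 : pi_special pi A3)
    (co12 : coprime #|G : A1| #|G : A2|)
    (co13 : coprime #|G : A1| #|G : A3|)
    (co23 : coprime #|G : A2| #|G : A3|)
    (ix1 : [pred q in pi].-nat #|G : A1| || [pred q in pi]^'.-nat #|G : A1|)
    (ix2 : [pred q in pi].-nat #|G : A2| || [pred q in pi]^'.-nat #|G : A2|)
    (ix3 : [pred q in pi].-nat #|G : A3| || [pred q in pi]^'.-nat #|G : A3|)
    (at_most_one :
       (count (fun m : nat => [pred q in pi]^'.-nat m)
          [:: #|G : A1|; #|G : A2|; #|G : A3|] <= 1)%N) :
  pi_special pi G.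
Proof.
have co21 : coprime #|G : A2| #|G : A1| by rewrite coprime_sym.
have co31 : coprime #|G : A3| #|G : A1| by rewrite coprime_sym.
have co32 : coprime #|G : A3| #|G : A2| by rewrite coprime_sym.
case/orP: ix1 => ix1; last first.
  move: at_most_one ix2 ix3; rewrite /= ix1 /=.
  case: (_^'.-nat #|G : A2|) => //; case: (_^'.-nat #|G : A3|) => // _.
  rewrite !orbF => ix2 ix3.
  exact: (@pi_special_pi_indices pi gT G A2 A3 A1).
case/orP: ix2 => ix2; last first.
  move: at_most_one ix3; rewrite /= ix2 /=.
  (* The index of [A1] may be 1, hence also a pi'-number, so its summand in the count is
     undetermined; [addnC] brings the other two to the front, and they already exceed the bound. *)
  case: (_^'.-nat #|G : A3|) => [|_]; first by rewrite addnC.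
  rewrite orbF => ix3.
  exact: (@pi_special_pi_indices pi gT G A1 A3 A2).
exact: (@pi_special_pi_indices pi gT G A1 A2 A3).
Qed.
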